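(* There exists a $(16,2;5,9;3,3)$-GSEDF (in some abelian group of order $16$).
   Context: Let $G$ be a finite abelian group of order $v$, written additively with identity $0$. For disjoint subsets $A,B\subseteq G$, let $\Delta(A,B)$ be the multiset $\{x-y : x\in A, y\in B\}$. For positive integers $k_1,k_2,\lambda_1,\lambda_2$, a $(v,2;k_1,k_2;\lambda_1,\lambda_2)$-generalized strong external difference family (GSEDF) in $G$ is a pair $\{D_1,D_2\}$ of disjoint subsets of $G$ with $|D_1|=k_1$, $|D_2|=k_2$ such that $\Delta(D_1,D_2)$ contains every element of $G\setminus\{0\}$ exactly $\lambda_1$ times and $\Delta(D_2,D_1)$ contains every element of $G\setminus\{0\}$ exactly $\lambda_2$ times. *)

(* Defs.v *)
From mathcomp Require Import all_boot all_algebra.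

Set Implicit Arguments.
Unset Strict Implicit.
Unset Printing Implicit Defensive.

Import GRing.Theory.
Local Open Scope ring_scope.

(* A multiset is a sequence read up to order; the multiplicity of g in it is
   count_mem g. *)
Definition Delta (G : finZmodType) (A B : {set G}) : seq G :=
  [seq x - y | x <- enum A, y <- enum B].

Definition is_GSEDF (G : finZmodType) (v k1 k2 lambda1 lambda2 : nat)
    (D1 D2 : {set G}) : Prop :=
  [/\ [/\ (0 < k1)%N, (0 < k2)%N, (0 < lambda1)%N & (0 < lambda2)%N],
      #|G| = v,
      [disjoint D1 & D2],
      #|D1| = k1 /\ #|D2| = k2 &
      forall g : G, g != 0 ->
        count_mem g (Delta D1 D2) = lambda1 /\
        count_mem g (Delta D2 D1) = lambda2].

(* Main.v *)
(* With D2 the complement of D1 and two further elements 0 and b, a character chi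
   with chi b = -1 must satisfy |chi(D1)|^2 = 3.  This is impossible in Z and in
   Z[i], so such chi must have order at least 8, but it holds in Z[zeta_8] for
   1 + sqrt(-2).  This suggests Z_2 x Z_8 with b = (0, 4); the blocks below were
   found by search there. *)
From HB Require Import structures.
Require Import Defs.
From mathcomp Require Import all_boot all_algebra.

(* MathComp does not declare the product of two finZmodTypes as a finZmodType. *)
HB.saturate prod.

Import GRing.Theory.
Local Open Scope ring_scope.

(** Reduces multiplicities to computation on explicit lists: [enum] returns the listed elements in
    some other order, which counting ignores. *)
Lemma count_Delta_seq (G : finZmodType) (s t : seq G) (g : G) :
    uniq s -> uniq t ->
  count_mem g (Delta [set x in s] [set y in t]) =
  count_mem g [seq x - y | x <- s, y <- t].
Proof.
have enum_perm (u : seq G) : uniq u -> perm_eq (enum [set x in u]) u.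
  move=> uu; apply: uniq_perm => // [|x]; first exact: enum_uniq.
  by rewrite mem_enum inE.
move=> /enum_perm Hs /enum_perm Ht.
by apply/permP: (pred1 g); apply: perm_allpairs.
Qed.

Lemma disjoint_set_seq (T : finType) (s t : seq T) :
  [disjoint [set x in s] & [set y in t]] = ~~ has [in t] s.
Proof.
have memE (u : seq T) : [set x in u] =i u by move=> x; rewrite inE.
by rewrite (eq_disjoint (memE s)) (eq_disjoint_r (memE t)) disjoint_has.
Qed.

Definition block (s : seq (nat * nat)) : seq ('I_2 * 'I_8) :=
  [seq (inZp p.1, inZp p.2) | p <- s].

(** If chi (0, 1) is a primitive 8th root of unity, (1, 0) and (1, 4) cancel and the rest sums to
    ±sqrt 2 ± i, of squared modulus 3. *)
Definition block1 := block [:: (0, 1); (0, 2); (0, 7); (1, 0); (1, 4)]%N.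

Definition block2 :=
  block [:: (0, 3); (0, 5); (0, 6);
            (1, 1); (1, 2); (1, 3); (1, 5); (1, 6); (1, 7)]%N.

Theorem theorem4p8 :
  exists (G : finZmodType) (D1 D2 : {set G}), is_GSEDF 16 5 9 3 3 D1 D2.
Proof.
have u1 : uniq block1 by vm_compute.
have u2 : uniq block2 by vm_compute.
exists ('I_2 * 'I_8)%type, [set x in block1], [set y in block2]; split=> //.
- by rewrite card_prod !card_ord.
- by rewrite disjoint_set_seq; vm_compute.
- by rewrite !cardsE (card_uniqP u1) (card_uniqP u2).
move=> g g0; rewrite !count_Delta_seq //; move: g0.
(* Sixteen cases; the bound proofs stay abstract, but equality of ordinals compares only values. At
   0 the premise computes to a contradiction. *)
by case: g => [[[|[|//]] ?] [[|[|[|[|[|[|[|[|//]]]]]]]] ?]]; vm_compute.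
Qed.
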